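(* Let $(X_i,Z_i)_{i\ge1}$ be i.i.d. with joint distribution $P_{XZ}$ on finite alphabets $\mathcal{X}\times\mathcal{Z}$, and let $D:\mathcal{X}\times\mathcal{X}\to[0,d_{\max}]$, $d_{\max}<\infty$. The rate-distortion-perception function with respect to the empirical perceptual constraint is \[ R^{(e)}(\Delta,\Pi)=\inf_{\substack{P_{Y|XZ}:\ \mathbb{E}[D(X,Y)]\le\Delta\\ d_{\mathrm{TV}}(P_X,P_Y)\le\Pi}} I(X;Y|Z), \] where the infimum is over conditional distributions of $Y\in\mathcal{X}$ given $(X,Z)\sim P_{XZ}$.
   Context: $d_{\mathrm{TV}}(P,Q)=\sup_A|P(A)-Q(A)|$; $\hat P_{x^n}(x)=\frac1n\sum_{i=1}^n\mathbf 1\{x_i=x\}$; $D(x^n,y^n)=\frac1n\sum_iD(x_i,y_i)$; $[m]=\{1,\dots,\lfloor m\rfloor\}$. An $(n,2^{nR},2^{nR_0})$ code consists of a (possibly stochastic) encoder $f_n:\mathcal{X}^n\times\mathcal{Z}^n\times[2^{nR_0}]\to[2^{nR}]$ and a (possibly stochastic) decoder $g_n:[2^{nR}]\times\mathcal{Z}^n\times[2^{nR_0}]\to\mathcal{X}^n$, with common randomness $K$ uniform on $[2^{nR_0}]$ independent of $(X^n,Z^n)$ and output $Y^n=g_n(f_n(X^n,Z^n,K),Z^n,K)$. $(R,R_0,\Delta,\Pi)$ is achievable with respect to empirical perception if for every $\epsilon>0$ there is a sequence of $(n,2^{n(R+\epsilon)},2^{n(R_0+\epsilon)})$ codes with $\mathbb{E}[D(X^n,Y^n)]\le\Delta+\epsilon$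 and $\mathbb{E}[d_{\mathrm{TV}}(\hat P_{X^n},\hat P_{Y^n})]\le\Pi+\epsilon$. $R^{(e)}(\Delta,\Pi)$ denotes the infimum of rates $R$ such that $(R,R_0,\Delta,\Pi)$ is achievable with respect to empirical perception for some $R_0\ge0$. *)

(* Defs.v *)
From HB Require Import structures.
From mathcomp Require Import all_boot all_order all_algebra.
From mathcomp Require Import all_classical all_reals all_analysis.
Set Implicit Arguments. Unset Strict Implicit. Unset Printing Implicit Defensive.
Import Order.TTheory GRing.Theory Num.Theory.
Local Open Scope ring_scope.

Section RDP.
Variable R : realType.

Definition is_pmf (T : finType) (p : T -> R) : Prop :=
  (forall t, 0 <= p t) /\ \sum_(t : T) p t = 1.

Definition log2 (x : R) : R := ln x / ln 2.

Definition plog (p q : R) : R := if p == 0 then 0 else p * log2 q.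

Definition dTV (T : finType) (P Q : T -> R) : R :=
  \big[Num.max/0]_(A : {set T}) `| \sum_(t in A) P t - \sum_(t in A) Q t |.

(* |[m]| = floor m, for m >= 0 *)
Definition card_of (m : R) : nat := Num.truncn m.

Definition pow2 (n : nat) (r : R) : R := powR 2 (n%:R * r).

Variables (X Z : finType).

Definition word (T : finType) (n : nat) := {ffun 'I_n -> T}.

Definition emp (n : nat) (xn : word X n) (x : X) : R :=
  (#|[set i | xn i == x]|)%:R / n%:R.

Definition Dn (D : X -> X -> R) (n : nat) (xn yn : word X n) : R :=
  (\sum_(i < n) D (xn i) (yn i)) / n%:R.

Definition Pn (PXZ : X -> Z -> R) (n : nat) (xn : word X n) (zn : word Z n) : R :=
  \prod_(i < n) PXZ (xn i) (zn i).

Definition valid_code (n M K : nat)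
  (enc : word X n -> word Z n -> 'I_K -> 'I_M -> R)
  (dec : 'I_M -> word Z n -> 'I_K -> word X n -> R) : Prop :=
  (forall xn zn k, is_pmf (enc xn zn k)) /\ (forall m zn k, is_pmf (dec m zn k)).

(* expectation of F(X^n, Y^n) under the joint law of the code;
   K uniform on 'I_K and independent of (X^n,Z^n) *)
Definition code_expect (PXZ : X -> Z -> R) (n M K : nat)
  (enc : word X n -> word Z n -> 'I_K -> 'I_M -> R)
  (dec : 'I_M -> word Z n -> 'I_K -> word X n -> R)
  (F : word X n -> word X n -> R) : R :=
  \sum_(xn : word X n) \sum_(zn : word Z n) \sum_(k : 'I_K) \sum_(m : 'I_M)
   \sum_(yn : word X n)
     Pn PXZ xn zn / K%:R * enc xn zn k m * dec m zn k yn * F xn yn.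

Definition achievable_emp (PXZ : X -> Z -> R) (D : X -> X -> R)
  (r r0 Delta Pi : R) : Prop :=
  forall eps : R, 0 < eps ->
  exists N : nat, forall n : nat, (N <= n)%N ->
    let M := card_of (pow2 n (r + eps)) in
    let K := card_of (pow2 n (r0 + eps)) in
    exists enc dec, @valid_code n M K enc dec /\
      code_expect PXZ enc dec (@Dn D n) <= Delta + eps /\
      code_expect PXZ enc dec (fun xn yn => dTV (@emp n xn) (@emp n yn))
        <= Pi + eps.

Definition Rop_emp (PXZ : X -> Z -> R) (D : X -> X -> R) (Delta Pi : R)
  : \bar R :=
  ereal_inf [set r%:E | r in [set r : R |
     exists r0 : R, 0 <= r0 /\ achievable_emp PXZ D r r0 Delta Pi]].

Definition joint (PXZ : X -> Z -> R) (W : X -> Z -> X -> R) (x : X) (z : Z) (y : X) : R :=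
  PXZ x z * W x z y.

Definition PX (PXZ : X -> Z -> R) (x : X) : R := \sum_(z : Z) PXZ x z.

Definition PY (PXZ : X -> Z -> R) (W : X -> Z -> X -> R) (y : X) : R :=
  \sum_(x : X) \sum_(z : Z) joint PXZ W x z y.

Definition exp_dist (PXZ : X -> Z -> R) (W : X -> Z -> X -> R) (D : X -> X -> R) : R :=
  \sum_(x : X) \sum_(z : Z) \sum_(y : X) joint PXZ W x z y * D x y.

Definition cond_MI (PXZ : X -> Z -> R) (W : X -> Z -> X -> R) : R :=
  let PZ z := \sum_(x : X) PXZ x z in
  let PYZ y z := \sum_(x : X) joint PXZ W x z y in
  \sum_(x : X) \sum_(z : Z) \sum_(y : X)
    plog (joint PXZ W x z y)
         ((joint PXZ W x z y * PZ z) / (PXZ x z * PYZ y z)).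

Definition Rinfo_emp (PXZ : X -> Z -> R) (D : X -> X -> R) (Delta Pi : R)
  : \bar R :=
  ereal_inf [set (cond_MI PXZ W)%:E | W in [set W : X -> Z -> X -> R |
     (forall x z, is_pmf (W x z)) /\
     exp_dist PXZ W D <= Delta /\ dTV (PX PXZ) (PY PXZ W) <= Pi]].

End RDP.

(* Main.v *)
(** Converse.  Let [J] be the joint law of the words of a code with [M] messages.
    Bounding the encoder probabilities by 1 gives [W_n(y|x,z) <= M Q(y|z)], with [Q] the
    law of the decoder output for a uniform message.  Let [Wbar] be the per-letter average
    of the code and [T] the product over the letters of the density of its joint law with
    respect to [P_{X|Z} P_{Y|Z} P_Z].  Then [n I(Wbar) = E_J log T], and
    [log (T/M) <= T/M - 1] together with [E_J[T/M] <= E_{P Q}[T] <= 1] yields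
    [n I(Wbar) <= log M] without any chain rule.  Distortion is linear and total variation
    convex, so [Wbar] is feasible up to epsilon; compactness of the set of channels and
    continuity of [x ln x] remove the epsilon.

    Achievability.  No common randomness is needed.  For each [z^n] draw [M] codewords
    i.i.d. from [prod P_{Y|Z}] and send the index of one that is typical with [(x^n,z^n)];
    if the channel puts mass [a] on typical words then one codeword is typical with
    probability at least [b a], [b = 2^{-n(I+d)}], and the miss probability is at most
    [(1 - b a)^M <= 1 - a + 1/(b M)].  Typicality of the letter frequencies of [x^n] and
    [y^n] controls the empirical total variation. *)
Require Import Defs.
From HB Require Import structures.
From mathcomp Require Import all_boot all_order all_algebra.
From mathcomp Require Import all_classical all_reals all_analysis.
From mathcomp Require Import ring lra.
Import Order.TTheory GRing.Theory Num.Theory.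
Import numFieldTopology.Exports numFieldNormedType.Exports.
Local Open Scope ring_scope.
Set Implicit Arguments. Unset Strict Implicit. Unset Printing Implicit Defensive.

(** * Laws of large numbers and random codebooks *)

Section Words.
Variables (R : realType) (A : finType).
Implicit Types (p f : A -> R) (n : nat).

Definition iid p n (w : word A n) : R := \prod_(i < n) p (w i).

Lemma iid_ge0 p n (w : word A n) : is_pmf p -> 0 <= iid p w.
Proof. by move=> [p0 _]; apply: prodr_ge0. Qed.

Lemma iid_pmf p n : is_pmf p -> is_pmf (@iid p n).
Proof.
move=> hp; split=> [w|]; first exact: iid_ge0.
rewrite /iid -(bigA_distr_bigA (fun (_ : 'I_n) a => p a)) big1 // => i _.
exact: hp.2.
Qed.

(** The word sum factors over coordinates; for [i != j] the factor at [i] is the mean of [f], which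
    is zero. *)
Lemma iid_cov p f n (i j : 'I_n) : is_pmf p -> \sum_a p a * f a = 0 ->
  \sum_w iid p w * (f (w i) * f (w j)) =
    if i == j then \sum_a p a * f a ^+ 2 else 0.
Proof.
move=> hp f0.
(* Both values of [f] are absorbed into the factors of the product law; for [i = j] they meet in one
   factor and give the square. *)
pose h (k : 'I_n) (a : A) : R :=
  p a * ((if k == i then f a else 1) * (if k == j then f a else 1)).
have -> : \sum_w iid p w * (f (w i) * f (w j)) = \sum_(w : word A n) \prod_k h k (w k).
  apply: eq_bigr => w _; rewrite /h big_split; congr (_ * _).
  rewrite big_split -!big_mkcond /=; congr (_ * _).
    by rewrite (big_pred1 i).
  by rewrite (big_pred1 j).
rewrite -(bigA_distr_bigA h) (bigD1 i) //=; case: (altP (i =P j)) => [ij|ij].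
  rewrite [X in _ * X]big1 ?mulr1 => [|k ki].
    by apply: eq_bigr => a _; rewrite /h -ij eqxx expr2.
  rewrite -hp.2; apply: eq_bigr => a _.
  by rewrite /h -ij (negbTE ki) !mulr1.
suff -> : \sum_a h i a = 0 by rewrite mul0r.
rewrite -[RHS]f0; apply: eq_bigr => a _.
by rewrite /h eqxx (negbTE ij) mulr1.
Qed.

Lemma iid_variance p f n : is_pmf p -> \sum_a p a * f a = 0 ->
  \sum_w iid p w * (\sum_(i < n) f (w i)) ^+ 2 = n%:R * \sum_a p a * f a ^+ 2.
Proof.
move=> hp f0.
under eq_bigr => w _.
  rewrite expr2 mulr_suml mulr_sumr.
  under eq_bigr => i _ do rewrite mulr_sumr mulr_sumr.
  over.
rewrite exchange_big /=.
under eq_bigr => i _.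
  rewrite exchange_big /=.
  under eq_bigr => j _ do rewrite (iid_cov i j hp f0).
  rewrite -big_mkcond /= (big_pred1 i); last by move=> j; rewrite eq_sym.
  over.
by rewrite sumr_const card_ord mulr_natl.
Qed.

Lemma iid_chebyshev p f n (d : R) : is_pmf p -> 0 < d -> (0 < n)%N ->
  \sum_w iid p w *
    (n%:R * d < `|\sum_(i < n) f (w i) - n%:R * \sum_a p a * f a|)%R%:R <=
  (\sum_a p a * (f a - \sum_b p b * f b) ^+ 2) / (n%:R * d ^+ 2).
Proof.
move=> hp d0 n0; set mu := \sum_a p a * f a; pose g a := f a - mu.
have g0 : \sum_a p a * g a = 0.
  under eq_bigr do rewrite mulrBr.
  by rewrite sumrB -mulr_suml hp.2 mul1r subrr.
have nR0 : 0 < n%:R :> R by rewrite ltr0n.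
have -> : (\sum_a p a * (f a - mu) ^+ 2) / (n%:R * d ^+ 2) =
   \sum_w iid p w * ((\sum_(i < n) g (w i)) ^+ 2 / (n%:R * d) ^+ 2).
  under [RHS]eq_bigr do rewrite mulrA.
  rewrite -mulr_suml (iid_variance n hp g0) /g.
  by field; rewrite !gt_eqF.
apply: ler_sum => w _; apply: ler_wpM2l; first exact: iid_ge0.
have -> : \sum_i f (w i) - n%:R * mu = \sum_i g (w i).
  by rewrite sumrB sumr_const card_ord mulr_natl.
set S := \sum_i _; case: ltP => h; last by rewrite divr_ge0 // sqr_ge0.
rewrite ler_pdivlMr ?exprn_gt0 ?mulr_gt0 // mul1r -[S ^+ 2]real_normK ?num_real //.
by rewrite lerXn2r ?nnegrE ?mulr_ge0 // ltW.
Qed.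

(** A union bound over the finitely many statistics, so that one [N] serves all of them at once. *)
Lemma weak_law (J : finType) p (f : J -> A -> R) (d eta : R) : is_pmf p ->
  0 < d -> 0 < eta ->
  exists N : nat, forall n, (N <= n)%N ->
  \sum_(w : word A n) iid p w *
    [exists j, n%:R * d <
       `|\sum_(i < n) f j (w i) - n%:R * \sum_a p a * f j a|]%:R <= eta.
Proof.
move=> hp d0 eta0.
pose V := \sum_j \sum_a p a * (f j a - \sum_b p b * f j b) ^+ 2.
have V0 : 0 <= V.
  apply: sumr_ge0 => j _; apply: sumr_ge0 => a _.
  by apply: mulr_ge0; [exact: hp.1 | exact: sqr_ge0].
(* From here on [V / (n d^2) <= eta], with [V] the sum of all variances; the successor also forces
   [n > 0]. *)
exists (Num.truncn (V / d ^+ 2 / eta)).+1 => n hn.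
have n0 : (0 < n)%N by exact: leq_trans hn.
have nR0 : 0 < n%:R :> R by rewrite ltr0n.
have hV : V / (n%:R * d ^+ 2) <= eta.
  have : V / d ^+ 2 / eta <= n%:R.
    by apply: ltW; apply: lt_le_trans (truncnS_gt _) _; rewrite ler_nat.
  rewrite !ler_pdivrMr ?mulr_gt0 ?exprn_gt0 // => hV.
  by apply: le_trans hV _; rewrite mulrAC mulrA [eta * _]mulrC mulrAC.
apply: le_trans hV; rewrite /V mulr_suml.
apply: le_trans (_ : \sum_w iid p w * \sum_j (n%:R * d <
       `|\sum_(i < n) f j (w i) - n%:R * \sum_a p a * f j a|)%R%:R <= _).
  apply: ler_sum => w _; apply: ler_wpM2l; first exact: iid_ge0.
  case: existsP => [[j hj]|_]; last by apply: sumr_ge0.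
  by rewrite (bigD1 j) //= hj lerDl; apply: sumr_ge0.
under eq_bigr do rewrite mulr_sumr.
rewrite exchange_big /=; apply: ler_sum => j _.
exact: iid_chebyshev.
Qed.

End Words.

(** The probabilistic method: if every value exceeded the mean, averaging would put the mean
    strictly above itself. *)
Lemma pmf_mean_witness (R : realType) (T : finType) (p g : T -> R) :
  is_pmf p -> exists t, g t <= \sum_s p s * g s.
Proof.
move=> hp; apply/not_existsP => h.
have : \sum_s p s * (\sum_t p t * g t) < \sum_s p s * g s.
  (* An atom of positive mass is what makes the averaged inequality strict. *)
  have [s ps] : exists s, p s != 0.
    apply/not_existsP => p0; have := hp.2.
    rewrite big1 => [/eqP|t _]; first by rewrite eq_sym oner_eq0.
    by apply: contrapT => /eqP /p0.
  rewrite (bigD1 s) //= [ltRHS](bigD1 s) //=.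
  apply: ltr_leD.
    have ps0 : 0 < p s by rewrite lt_def ps hp.1.
    by rewrite ltr_pM2l // ltNge; apply/negP.
  apply: ler_sum => t _; apply: ler_wpM2l; first exact: hp.1.
  rewrite leNgt; apply/negP => /ltW; exact: h.
by rewrite -mulr_suml hp.2 mul1r ltxx.
Qed.

(* The codebook is drawn i.i.d. from [q]; the probability that it misses [u] is
   then exactly the power on the right-hand side. *)
Lemma random_codebook (R : realType) (U Y : finType) (w : U -> R) (q : Y -> R)
    (good : U -> Y -> bool) (M : nat) : is_pmf q ->
  exists c : word Y M,
    \sum_u w u * (~~ [exists m, good u (c m)])%:R <=
    \sum_u w u * (1 - \sum_y q y * (good u y)%:R) ^+ M.
Proof.
move=> hq.
have [c hc] := pmf_mean_witness (fun c : word Y M =>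
  \sum_u w u * (~~ [exists m, good u (c m)])%:R) (iid_pmf M hq).
exists c; apply: le_trans hc _; rewrite le_eqVlt; apply/orP; left; apply/eqP.
under eq_bigr do rewrite mulr_sumr.
rewrite exchange_big /=; apply: eq_bigr => u _.
under eq_bigr do rewrite mulrCA.
rewrite -mulr_sumr; congr (_ * _).
(* As a product of [M] sums over single codewords, the power distributes into a sum over
   codebooks. *)
have -> : (1 - \sum_y q y * (good u y)%:R) ^+ M =
    \prod_(m < M) \sum_y q y * (~~ good u y)%:R.
  rewrite prodr_const card_ord; congr (_ ^+ _).
  rewrite -[X in X - _]hq.2 -sumrB; apply: eq_bigr => y _.
  by case: (good u y); rewrite /= ?mulr1 ?mulr0 ?subrr ?subr0.
rewrite bigA_distr_bigA; apply: eq_bigr => d _.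
rewrite big_split; congr (_ * _) => /=.
case: existsP => [[m hm]|h]; first by rewrite (bigD1 m) //= hm mul0r.
rewrite big1 // => m _; case: (boolP (good u (d m))) => // hm.
by case: h; exists m.
Qed.

(** Bernoulli's inequality gives [(1 - q)^M <= 1 / (1 + M q)]. The resulting bound is affine in [a],
    so it can later be averaged over source words and [1 - a] read as a probability. *)
Lemma miss_probability_le (R : realFieldType) (M : nat) (a b q : R) :
  0 <= a <= 1 -> 0 < b -> b * a <= q -> q <= 1 -> (0 < M)%N ->
  (1 - q) ^+ M <= 1 - a + (b * M%:R)^-1.
Proof.
move=> /andP[a0 a1] b0 baq q1 M0.
have MR0 : 0 < M%:R :> R by rewrite ltr0n.
have q0 : 0 <= q by apply: le_trans baq; rewrite mulr_ge0 // ltW.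
have bern : forall k : nat, (1 - q) ^+ k * (1 + k%:R * q) <= 1.
  elim=> [|k IH]; first by rewrite mul0r addr0 mulr1.
  rewrite exprS mulrAC; apply: le_trans IH; rewrite [leRHS]mulrC.
  apply: ler_wpM2r; first by rewrite exprn_ge0 // subr_ge0.
  rewrite -natr1.
  have : 0 <= k%:R * q ^+ 2 + q ^+ 2 by rewrite addr_ge0 ?mulr_ge0 ?sqr_ge0.
  lra.
have Mq : 0 <= M%:R * q by rewrite mulr_ge0 // ltW.
set s := b * M%:R; have s0 : 0 < s by rewrite mulr_gt0.
have sa : s * a <= M%:R * q by rewrite /s mulrAC mulrC ler_wpM2l // ltW.
(* With [s = b M], the product [(1 + s a) (1 - a + 1/s)] exceeds 1 by exactly
   [1/s + s a (1 - a)]. *)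
have h : 1 <= (1 + M%:R * q) * (1 - a + s^-1).
  apply: le_trans (_ : (1 + s * a) * (1 - a + s^-1) <= _).
    have -> : (1 + s * a) * (1 - a + s^-1) = 1 + s^-1 + s * a * (1 - a).
      by field; rewrite gt_eqF.
    have : 0 <= s * a * (1 - a) by rewrite !mulr_ge0 ?subr_ge0 // ltW.
    have : 0 < s^-1 by rewrite invr_gt0.
    lra.
  apply: ler_wpM2r; last lra.
  by rewrite addr_ge0 ?subr_ge0 // invr_ge0 ltW.
rewrite -(@ler_pM2r _ (1 + M%:R * q)); last lra.
by apply: le_trans (bern M) _; rewrite mulrC.
Qed.

(** * Single-letter information quantities *)

Lemma sum_triple (R : realType) (A B C : finType) (F : A -> B -> C -> R) :
  \sum_a \sum_b \sum_c F a b c = \sum_(t : A * B * C) F t.1.1 t.1.2 t.2.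
Proof. by rewrite pair_big pair_big. Qed.

Lemma sum_word2 (R : realType) (A B : finType) n (G : word A n -> word B n -> R) :
  \sum_a \sum_b G a b =
  \sum_(w : word (A * B)%type n) G [ffun i => (w i).1] [ffun i => (w i).2].
Proof.
rewrite pair_big /=.
rewrite (reindex (fun w : word (A * B)%type n =>
  ([ffun i => (w i).1] : word A n, [ffun i => (w i).2] : word B n))) //=.
exists (fun u : word A n * word B n => [ffun i => (u.1 i, u.2 i)]) => [w _|[a b] _] /=.
  by apply/ffunP => i; rewrite !ffunE -surjective_pairing.
by congr (_, _); apply/ffunP => i; rewrite !ffunE.
Qed.

Section Information.
Variables (R : realType) (X Z : finType) (PXZ : X -> Z -> R).
Hypothesis hP : is_pmf (fun xz : X * Z => PXZ xz.1 xz.2).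
Implicit Types (W : X -> Z -> X -> R).

Definition PZ z := \sum_x PXZ x z.
Definition PYZ W y z := \sum_x joint PXZ W x z y.
(** The density of the joint law with respect to [P_{X|Z} P_{Y|Z} P_Z]. Division by zero makes it 0
    off the support. *)
Definition dens W x z y := (joint PXZ W x z y * PZ z) / (PXZ x z * PYZ W y z).
Definition channel W := forall x z, is_pmf (W x z).

Lemma PXZ_ge0 x z : 0 <= PXZ x z.
Proof. exact: (hP.1 (x, z)). Qed.

Lemma PZ_ge0 z : 0 <= PZ z.
Proof. by apply: sumr_ge0 => x _; exact: PXZ_ge0. Qed.

Lemma sum_PZ : \sum_z PZ z = 1.
Proof. by rewrite /PZ exchange_big pair_big; exact: hP.2. Qed.

Lemma joint_ge0 W x z y : channel W -> 0 <= joint PXZ W x z y.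
Proof. by move=> hW; rewrite mulr_ge0 ?PXZ_ge0 ?(hW _ _).1. Qed.

Lemma PYZ_ge0 W y z : channel W -> 0 <= PYZ W y z.
Proof. by move=> hW; apply: sumr_ge0 => x _; exact: joint_ge0. Qed.

Lemma sum_joint W x z : channel W -> \sum_y joint PXZ W x z y = PXZ x z.
Proof. by move=> hW; rewrite -mulr_sumr (hW _ _).2 mulr1. Qed.

Lemma sum_PYZ W z : channel W -> \sum_y PYZ W y z = PZ z.
Proof.
move=> hW; rewrite /PYZ exchange_big /=.
by apply: eq_bigr => x _; exact: sum_joint.
Qed.

Lemma sum_joint3 W : channel W -> \sum_x \sum_z \sum_y joint PXZ W x z y = 1.
Proof.
move=> hW; under eq_bigr => x _ do under eq_bigr => z _ do rewrite sum_joint //.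
by rewrite pair_big; exact: hP.2.
Qed.

Lemma joint_gt0_marg W x z y : channel W -> 0 < joint PXZ W x z y ->
  [/\ 0 < PXZ x z, 0 < PZ z & 0 < PYZ W y z].
Proof.
move=> hW h; have p0 : 0 < PXZ x z.
  by rewrite lt_def PXZ_ge0 andbT; apply: contraTneq h => p0;
    rewrite /joint p0 mul0r ltxx.
split=> //.
  apply: lt_le_trans p0 _; rewrite /PZ (bigD1 x) //= lerDl.
  by apply: sumr_ge0 => *; exact: PXZ_ge0.
apply: lt_le_trans h _; rewrite /PYZ (bigD1 x) //= lerDl.
by apply: sumr_ge0 => *; exact: joint_ge0.
Qed.

Lemma dens_ge0 W x z y : channel W -> 0 <= dens W x z y.
Proof.
by move=> hW; rewrite divr_ge0 // mulr_ge0 ?joint_ge0 ?PZ_ge0 ?PXZ_ge0 ?PYZ_ge0.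
Qed.

Lemma dens_gt0 W x z y : channel W -> 0 < joint PXZ W x z y -> 0 < dens W x z y.
Proof.
by move=> hW h; have [? ? ?] := joint_gt0_marg hW h; rewrite divr_gt0 // mulr_gt0.
Qed.

Lemma cond_MIE W : cond_MI PXZ W =
  (\sum_x \sum_z \sum_y joint PXZ W x z y * ln (dens W x z y)) / ln 2.
Proof.
rewrite /cond_MI mulr_suml; apply: eq_bigr => x _.
rewrite mulr_suml; apply: eq_bigr => z _.
rewrite mulr_suml; apply: eq_bigr => y _.
rewrite /plog; case: eqP => [->|_]; first by rewrite !mul0r.
by rewrite /log2 /dens mulrA.
Qed.

(** For [PYZ W y z != 0] the summand is [PZ z] times the conditional law of [x] given [(y, z)], and
    equality holds; otherwise the density is 0. This is the one-letter case of [E_{P Q}[T] <= 1]. *)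
Lemma sum_PXZ_dens_le W z y : channel W ->
  \sum_x PXZ x z * dens W x z y <= PZ z.
Proof.
move=> hW; have [y0|y0] := eqVneq (PYZ W y z) 0.
  rewrite big1 ?PZ_ge0 // => x _.
  by rewrite /dens y0 mulr0 invr0 !mulr0.
apply: le_trans (_ : \sum_x joint PXZ W x z y * (PZ z / PYZ W y z) <= _).
  apply: ler_sum => x _; have [p0|p0] := eqVneq (PXZ x z) 0.
    by rewrite /joint p0 !mul0r.
  rewrite le_eqVlt; apply/orP; left; apply/eqP; rewrite /dens.
  by field; rewrite y0.
by rewrite -mulr_suml -/(PYZ W y z) mulrC divfK.
Qed.

(* Gibbs' inequality in the form [ln t >= 1 - 1/t]. *)
Lemma cond_MI_ge0 W : channel W -> 0 <= cond_MI PXZ W.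
Proof.
move=> hW; rewrite cond_MIE; apply: divr_ge0; last by rewrite ln_ge0 // ler1n.
(* On the support the new summand is [joint * (1 - 1 / dens)]; its total is 1 minus a mass of at
   most 1. *)
apply: le_trans (_ : \sum_x \sum_z \sum_y
  (joint PXZ W x z y - PXZ x z * PYZ W y z / PZ z) <= _); last first.
  apply: ler_sum => x _; apply: ler_sum => z _; apply: ler_sum => y _.
  have := joint_ge0 x z y hW; rewrite le_eqVlt => /predU1P[<-|j0].
    rewrite mul0r sub0r oppr_le0.
    by rewrite divr_ge0 ?PZ_ge0 // mulr_ge0 ?PXZ_ge0 ?PYZ_ge0.
  have [p0 pz0 py0] := joint_gt0_marg hW j0; have d0 := dens_gt0 hW j0.
  have -> : joint PXZ W x z y - PXZ x z * PYZ W y z / PZ z =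
      joint PXZ W x z y * (1 - (dens W x z y)^-1).
    by rewrite /dens; field; rewrite !gt_eqF // mulr_gt0.
  rewrite ler_pM2l // -[dens W x z y in leRHS]invrK lnV ?posrE ?invr_gt0 //.
  rewrite -[leLHS]opprK lerN2 opprB.
  have := @le_ln1Dx R ((dens W x z y)^-1 - 1).
  rewrite addrCA subrr addr0; apply.
  by rewrite ltrBrDr addNr invr_gt0.
under eq_bigr => x _ do under eq_bigr => z _ do rewrite sumrB.
under eq_bigr => x _ do rewrite sumrB.
rewrite sumrB (sum_joint3 hW) subr_ge0.
rewrite exchange_big /= -sum_PZ; apply: ler_sum => z _.
under eq_bigr => x _ do rewrite -mulr_suml -mulr_sumr (sum_PYZ _ hW).
rewrite -mulr_suml -mulr_suml -/(PZ z).
have [->|z0] := eqVneq (PZ z) 0; first by rewrite !mul0r.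
by rewrite mulfK.
Qed.

End Information.

(** * Converse *)

Section Converse.
Variables (R : realType) (X Z : finType) (PXZ : X -> Z -> R).
Hypothesis hP : is_pmf (fun xz : X * Z => PXZ xz.1 xz.2).
Implicit Types (W : X -> Z -> X -> R).

Lemma Pn_ge0 n (xn : word X n) (zn : word Z n) : 0 <= Pn PXZ xn zn.
Proof. by apply: prodr_ge0 => i _; exact: (PXZ_ge0 hP). Qed.

Lemma sum_Pn_x n (zn : word Z n) :
  \sum_(xn : word X n) Pn PXZ xn zn = \prod_i PZ PXZ (zn i).
Proof. by rewrite /Pn -(bigA_distr_bigA (fun i x => PXZ x (zn i))). Qed.

Lemma sum_prod_PZ n : \sum_(zn : word Z n) \prod_i PZ PXZ (zn i) = 1.
Proof.
rewrite -(bigA_distr_bigA (fun (i : 'I_n) z => PZ PXZ z)) big1 // => i _.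
exact: sum_PZ.
Qed.

Lemma sum_Pn n : \sum_(xn : word X n) \sum_(zn : word Z n) Pn PXZ xn zn = 1.
Proof.
by rewrite exchange_big -[RHS](sum_prod_PZ n); apply: eq_bigr => zn _; rewrite sum_Pn_x.
Qed.

Lemma Pn_marginal n (i : 'I_n) (g : X -> Z -> R) :
  \sum_(xn : word X n) \sum_(zn : word Z n) Pn PXZ xn zn * g (xn i) (zn i) =
  \sum_x \sum_z PXZ x z * g x z.
Proof.
rewrite sum_word2 [RHS]pair_big /=.
pose h (k : 'I_n) (a : X * Z) := PXZ a.1 a.2 * (if k == i then g a.1 a.2 else 1).
transitivity (\sum_(w : word (X * Z)%type n) \prod_k h k (w k)).
  apply: eq_bigr => w _; rewrite big_split -big_mkcond /= [X in _ = _ * X](big_pred1 i) //.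
  by rewrite !ffunE; congr (_ * _); apply: eq_bigr => k _; rewrite !ffunE.
rewrite -(bigA_distr_bigA h) (bigD1 i) //= [X in _ * X]big1 ?mulr1.
  by apply: eq_bigr => a _; rewrite /h eqxx.
move=> k ki; rewrite -[RHS](hP.2); apply: eq_bigr => a _.
by rewrite /h (negbTE ki) mulr1.
Qed.

(** * Single-letterization of a block kernel *)

Section Blockwise.
Variables (n : nat) (Wn : word X n -> word Z n -> word X n -> R).
Hypothesis n0 : (0 < n)%N.
Hypothesis hWn : forall xn zn, is_pmf (Wn xn zn).

Definition Jn xn zn yn := Pn PXZ xn zn * Wn xn zn yn.

(** The expected joint type of the three words, or equally the average over positions of the law of
    one letter triple. *)
Definition Jbar x z y := \sum_xn \sum_zn \sum_yn Jn xn zn yn *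
  ((\sum_(i < n) ((xn i, zn i, yn i) == (x, z, y))%:R) / n%:R).

(** The identity channel where [PXZ x z = 0] is an arbitrary choice that keeps every row a pmf. *)
Definition Wbar x z y :=
  if PXZ x z == 0 then (y == x)%:R else Jbar x z y / PXZ x z.

Lemma Jn_ge0 xn zn yn : 0 <= Jn xn zn yn.
Proof. by rewrite mulr_ge0 ?Pn_ge0 ?(hWn _ _).1. Qed.

Lemma Jbar_ge0 x z y : 0 <= Jbar x z y.
Proof.
do 3! (apply: sumr_ge0 => ? _).
by rewrite mulr_ge0 ?Jn_ge0 // divr_ge0 // sumr_ge0.
Qed.

(** Counting letter triples by position. Marginals, distortion, event probabilities and the
    information are all obtained from this identity by choosing [f]. *)
Lemma sum_Jbar (f : X -> Z -> X -> R) :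
  \sum_x \sum_z \sum_y Jbar x z y * f x z y =
  \sum_xn \sum_zn \sum_yn Jn xn zn yn * ((\sum_i f (xn i) (zn i) (yn i)) / n%:R).
Proof.
rewrite (sum_triple (fun x z y => Jbar x z y * f x z y)).
rewrite (sum_triple (fun xn zn yn =>
  Jn xn zn yn * ((\sum_i f (xn i) (zn i) (yn i)) / n%:R))).
under eq_bigr => a _.
  rewrite /Jbar (sum_triple (fun xn zn yn => Jn xn zn yn *
    ((\sum_(i < n) ((xn i, zn i, yn i) == (a.1.1, a.1.2, a.2))%:R) / n%:R))) mulr_suml.
  over.
rewrite exchange_big /=; apply: eq_bigr => u _.
under eq_bigr do rewrite -mulrA.
rewrite -mulr_sumr; congr (_ * _).
under [LHS]eq_bigr do rewrite -mulrA mulr_suml.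
rewrite exchange_big mulr_suml /=; apply: eq_bigr => i _.
rewrite (bigD1 (u.1.1 i, u.1.2 i, u.2 i)) //= eqxx mul1r mulrC big1 ?addr0 //.
move=> [[x z] y] /= /negbTE h.
by rewrite eq_sym h mul0r.
Qed.

Lemma sum_Jn xn zn : \sum_yn Jn xn zn yn = Pn PXZ xn zn.
Proof. by rewrite -mulr_sumr (hWn _ _).2 mulr1. Qed.

Lemma Jbar_marginal x z : \sum_y Jbar x z y = PXZ x z.
Proof.
have nR : n%:R != 0 :> R by rewrite pnatr_eq0 -lt0n.
have pick (g : X -> Z -> R) :
    \sum_a \sum_b g a b * ((a, b) == (x, z))%:R = g x z.
  rewrite pair_big (bigD1 (x, z)) //= eqxx mulr1 big1 ?addr0 // => -[a b] /= h.
  by rewrite (negbTE h) mulr0.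
have := sum_Jbar (fun a b _ => ((a, b) == (x, z))%:R).
under eq_bigr => a _ do under eq_bigr => b _ do rewrite -mulr_suml.
rewrite pick => ->.
under eq_bigr => xn _.
  under eq_bigr => zn _ do rewrite -mulr_suml sum_Jn mulrA mulr_sumr.
  rewrite -mulr_suml exchange_big /=.
  over.
rewrite -mulr_suml exchange_big /=.
under eq_bigr => i _ do rewrite (Pn_marginal i (fun a b => ((a, b) == (x, z))%:R)) pick.
by rewrite sumr_const card_ord -[X in X / _]mulr_natr mulfK.
Qed.

(** Where [PXZ x z = 0], [Jbar] vanishes as well, being nonnegative with marginal [PXZ]; the default
    in [Wbar] is therefore invisible. *)
Lemma joint_Wbar x z y : joint PXZ Wbar x z y = Jbar x z y.
Proof.
rewrite /joint /Wbar; case: eqP => [p0|/eqP p0]; last by rewrite mulrC divfK.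
rewrite p0 mul0r; apply/esym/eqP; rewrite eq_le Jbar_ge0 andbT -p0 -Jbar_marginal.
by rewrite (bigD1 y) //= lerDl sumr_ge0 // => *; exact: Jbar_ge0.
Qed.

Lemma Wbar_channel : channel Wbar.
Proof.
move=> x z; rewrite /Wbar; case: eqP => [p0|/eqP p0]; split.
- by [].
- by rewrite (bigD1 x) //= eqxx big1 ?addr0 // => y /negbTE ->.
- by move=> y; rewrite divr_ge0 ?Jbar_ge0 // PXZ_ge0.
- by rewrite -mulr_suml Jbar_marginal divff.
Qed.

Lemma sum_joint_Wbar (f : X -> Z -> X -> R) :
  \sum_x \sum_z \sum_y joint PXZ Wbar x z y * f x z y =
  \sum_xn \sum_zn \sum_yn Jn xn zn yn * ((\sum_i f (xn i) (zn i) (yn i)) / n%:R).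
Proof.
rewrite -sum_Jbar; do 3! (apply: eq_bigr => ? _).
by rewrite joint_Wbar.
Qed.

(** Makes every factor of [Tn] positive on the support of [Jn], so that exponentiating the sum of
    the logarithms recovers [Tn]. *)
Lemma Jn_letter_gt0 xn zn yn i : 0 < Jn xn zn yn ->
  0 < joint PXZ Wbar (xn i) (zn i) (yn i).
Proof.
move=> j0; rewrite joint_Wbar /Jbar.
pose F a b c := Jn a b c *
  ((\sum_(k < n) ((a k, b k, c k) == (xn i, zn i, yn i))%:R) / n%:R).
rewrite (sum_triple F) (bigD1 (xn, zn, yn)) //= ltr_wpDr //.
  apply: sumr_ge0 => u _.
  by rewrite /F mulr_ge0 ?Jn_ge0 // divr_ge0 // sumr_ge0.
rewrite /F mulr_gt0 // divr_gt0 ?ltr0n // (bigD1 i) //= eqxx.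
by rewrite ltr_wpDr ?ltr01 // sumr_ge0.
Qed.

Definition Tn (xn : word X n) (zn : word Z n) (yn : word X n) : R :=
  \prod_i dens PXZ Wbar (xn i) (zn i) (yn i).

Lemma Tn_ge0 xn zn yn : 0 <= Tn xn zn yn.
Proof. by apply: prodr_ge0 => i _; by apply: (dens_ge0 hP); exact: Wbar_channel. Qed.

(* Both the data-processing step and the single-letterization are contained in
   Gibbs' inequality applied to the product density [Tn], once [Wn] is dominated by
   [M] times a kernel [Q] that does not depend on [xn]. *)
Lemma single_letter_bound (M : nat) (Q : word Z n -> word X n -> R) :
  (0 < M)%N -> (forall zn, is_pmf (Q zn)) ->
  (forall xn zn yn, Wn xn zn yn <= M%:R * Q zn yn) ->
  n%:R * cond_MI PXZ Wbar * ln 2 <= ln (M%:R : R).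
Proof.
move=> M0 hQ hWQ; have MR : 0 < M%:R :> R by rewrite ltr0n.
have nR : n%:R != 0 :> R by rewrite pnatr_eq0 -lt0n.
have l2 : ln 2 != 0 :> R by rewrite gt_eqF // ln_gt0 // ltr1n.
pose S (xn : word X n) (zn : word Z n) (yn : word X n) := \sum_i ln (dens PXZ Wbar (xn i) (zn i) (yn i)).
have -> : n%:R * cond_MI PXZ Wbar * ln 2 =
    \sum_xn \sum_zn \sum_yn Jn xn zn yn * S xn zn yn.
  rewrite cond_MIE -mulrA divfK // sum_joint_Wbar mulr_sumr.
  apply: eq_bigr => xn _; rewrite mulr_sumr; apply: eq_bigr => zn _.
  rewrite mulr_sumr; apply: eq_bigr => yn _.
  by rewrite -/(S xn zn yn); field.
have sumJ : \sum_xn \sum_zn \sum_yn Jn xn zn yn = 1.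
  rewrite -[RHS](sum_Pn n); apply: eq_bigr => xn _; apply: eq_bigr => zn _.
  exact: sum_Jn.
(* This is [ln u <= u - 1] at [u = Tn / M], weighted by [Jn]; the domination [Wn <= M Q] then
   cancels [M]. Off the support of [Jn] the right-hand side is just nonnegative. *)
have key xn zn yn : Jn xn zn yn * S xn zn yn <=
    Pn PXZ xn zn * Q zn yn * Tn xn zn yn + (ln (M%:R : R) - 1) * Jn xn zn yn.
  have := Jn_ge0 xn zn yn; rewrite le_eqVlt => /predU1P[<-|j0].
    rewrite mul0r mulr0 addr0 mulr_ge0 ?Tn_ge0 // mulr_ge0 ?Pn_ge0 //.
    exact: (hQ _).1.
  apply: le_trans (_ : Jn xn zn yn * (Tn xn zn yn / M%:R - 1 + ln M%:R) <= _).
    rewrite ler_pM2l // -lerBlDr lerBrDl.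
    apply: le_trans (expR_ge1Dx _) _; rewrite expRB lnK ?posrE //.
    rewrite /S expR_sum ler_pM2r ?invr_gt0 //.
    rewrite le_eqVlt; apply/orP; left; apply/eqP; apply: eq_bigr => i _.
    rewrite lnK // posrE; apply: (dens_gt0 hP); first exact: Wbar_channel.
    exact: Jn_letter_gt0.
  have -> : Jn xn zn yn * (Tn xn zn yn / M%:R - 1 + ln M%:R) =
      Jn xn zn yn / M%:R * Tn xn zn yn + (ln M%:R - 1) * Jn xn zn yn.
    by field; rewrite gt_eqF.
  rewrite lerD2r ler_wpM2r ?Tn_ge0 // ler_pdivrMr // /Jn -mulrA.
  by rewrite ler_wpM2l ?Pn_ge0 // mulrC.
apply: le_trans (_ : \sum_xn \sum_zn \sum_yn
  (Pn PXZ xn zn * Q zn yn * Tn xn zn yn + (ln (M%:R : R) - 1) * Jn xn zn yn) <= _).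
  by do 3! (apply: ler_sum => ? _).
under eq_bigr => xn _ do under eq_bigr => zn _ do rewrite big_split -mulr_sumr /=.
under eq_bigr => xn _ do rewrite big_split -mulr_sumr /=.
rewrite big_split -mulr_sumr /= sumJ mulr1.
rewrite addrCA gerDl subr_le0.
(* It remains to bound the total of [Pn * Q * Tn] by 1. For fixed [zn] and [yn] the sum over [xn]
   factors into letters, each at most [PZ (zn i)]. *)
rewrite exchange_big /= -[leRHS](sum_prod_PZ n); apply: ler_sum => zn _.
rewrite exchange_big /= -[leRHS]mul1r -[X in _ <= X * _](hQ zn).2 mulr_suml; apply: ler_sum => yn _.
under eq_bigr => xn _ do rewrite mulrAC mulrC.
rewrite -mulr_sumr; apply: ler_wpM2l; first exact: (hQ _).1.
rewrite (eq_bigr (fun xn : word X n => \prod_i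
  (PXZ (xn i) (zn i) * dens PXZ Wbar (xn i) (zn i) (yn i)))); last first.
  by move=> xn _; rewrite big_split.
rewrite -(bigA_distr_bigA (fun i x => PXZ x (zn i) * dens PXZ Wbar x (zn i) (yn i))).
apply: ler_prod => i _; rewrite sum_PXZ_dens_le ?andbT //; last exact: Wbar_channel.
apply: sumr_ge0 => x _; rewrite mulr_ge0 ?(PXZ_ge0 hP) //.
by apply: (dens_ge0 hP); exact: Wbar_channel.
Qed.

End Blockwise.
End Converse.

(** * Empirical laws and total variation *)

Lemma sum_emp (R : realType) (X : finType) n (xn : word X n) (A : {set X}) :
  \sum_(t in A) emp R xn t = (\sum_i (xn i \in A)%:R) / n%:R.
Proof.
rewrite /emp -mulr_suml; congr (_ / _).
under eq_bigr do rewrite -sum1_card natr_sum.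
rewrite [RHS](eq_bigr (fun i => \sum_(t in A) (xn i == t)%:R)) => [|i _].
  rewrite exchange_big /=; apply: eq_bigr => t _.
  rewrite big_mkcond /=; apply: eq_bigr => i _.
  by rewrite inE; case: (xn i == t).
case: (boolP (xn i \in A)) => h.
  rewrite (bigD1 (xn i)) //= eqxx big1 ?addr0 // => t /andP[_ /negbTE].
  by rewrite eq_sym => ->.
rewrite big1 // => t tA; case: eqP => // e.
by rewrite e tA in h.
Qed.

Lemma dTV_ge (R : realType) (T : finType) (P Q : T -> R) (A : {set T}) :
  `|\sum_(t in A) P t - \sum_(t in A) Q t| <= dTV P Q.
Proof. exact: (le_bigmax _ (fun A : {set T} => `|\sum_(t in A) P t - \sum_(t in A) Q t|)). Qed.

Lemma dTV_le (R : realType) (T : finType) (P Q : T -> R) c : 0 <= c ->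
  (forall A : {set T}, `|\sum_(t in A) P t - \sum_(t in A) Q t| <= c) ->
  dTV P Q <= c.
Proof. by move=> c0 h; apply: bigmax_le => // A _; exact: h. Qed.

Lemma dTV_ge0 (R : realType) (T : finType) (P Q : T -> R) : 0 <= dTV P Q.
Proof. exact: le_trans (normr_ge0 _) (dTV_ge P Q finset.set0). Qed.

Lemma pow2_ge1 (R : realType) n (s : R) : 0 <= s -> 1 <= pow2 n s.
Proof.
by move=> s0; rewrite /pow2 -[leLHS](powRr0 2) ler_powR ?ler1n // mulr_ge0 ?ler0n.
Qed.

(** * From a code to a single-letter channel *)

Section CodeConverse.
Variables (R : realType) (X Z : finType) (PXZ : X -> Z -> R) (D : X -> X -> R).
Hypothesis hP : is_pmf (fun xz : X * Z => PXZ xz.1 xz.2).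

Lemma sum_PX_setE (W : X -> Z -> X -> R) (A : {set X}) : channel W ->
  \sum_(t in A) PX PXZ t =
  \sum_x \sum_z \sum_y joint PXZ W x z y * (x \in A)%:R.
Proof.
move=> hW; rewrite big_mkcond /=; apply: eq_bigr => x _.
under [RHS]eq_bigr do rewrite -mulr_suml sum_joint //.
rewrite -mulr_suml -/(PX PXZ x).
by case: (x \in A); rewrite ?mulr1 ?mulr0.
Qed.

Lemma sum_PY_setE (W : X -> Z -> X -> R) (A : {set X}) :
  \sum_(t in A) PY PXZ W t =
  \sum_x \sum_z \sum_y joint PXZ W x z y * (y \in A)%:R.
Proof.
rewrite exchange_big /=; apply: eq_bigr => x _.
rewrite exchange_big /=; apply: eq_bigr => z _.
rewrite big_mkcond /=; apply: eq_bigr => y _.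
by case: (y \in A); rewrite ?mulr1 ?mulr0.
Qed.

(** Averaging over messages and common randomness turns the code into a block kernel, whose [Wbar]
    is the witness. Distortion is linear, hence preserved exactly; total variation can only decrease
    under averaging. *)
Lemma code_converse (n M K : nat)
    (enc : word X n -> word Z n -> 'I_K -> 'I_M -> R)
    (dec : 'I_M -> word Z n -> 'I_K -> word X n -> R) :
  (0 < n)%N -> (0 < M)%N -> (0 < K)%N -> valid_code enc dec ->
  exists W, [/\ channel W, n%:R * cond_MI PXZ W * ln 2 <= ln (M%:R : R),
    exp_dist PXZ W D = code_expect PXZ enc dec (@Dn R X D n) &
    dTV (PX PXZ) (PY PXZ W) <=
      code_expect PXZ enc dec (fun xn yn => dTV (@emp R X n xn) (@emp R X n yn))].
Proof.
move=> n0 M0 K0 [henc hdec].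
have MR : 0 < M%:R :> R by rewrite ltr0n.
have KR : 0 < K%:R :> R by rewrite ltr0n.
pose Wn xn zn yn := \sum_k \sum_m enc xn zn k m * dec m zn k yn / K%:R.
pose Q zn yn := \sum_k \sum_m dec m zn k yn / (M%:R * K%:R).
have hWn xn zn : is_pmf (Wn xn zn).
  split=> [yn|].
    do 2! (apply: sumr_ge0 => ? _).
    by rewrite divr_ge0 ?mulr_ge0 ?(henc _ _ _).1 ?(hdec _ _ _).1 // ltW.
  rewrite exchange_big /=.
  under eq_bigr => k _.
    rewrite exchange_big /=.
    under eq_bigr => m _ do rewrite -mulr_suml -mulr_sumr (hdec _ _ _).2 mulr1.
    rewrite -mulr_suml (henc _ _ _).2 mul1r.
    over.
  by rewrite sumr_const card_ord -[LHS]mulr_natr mulVf // gt_eqF.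
have hQ zn : is_pmf (Q zn).
  split=> [yn|].
    do 2! (apply: sumr_ge0 => ? _).
    by rewrite divr_ge0 ?mulr_ge0 ?(hdec _ _ _).1 // ltW.
  rewrite exchange_big /=.
  under eq_bigr => k _.
    rewrite exchange_big /=.
    under eq_bigr => m _ do rewrite -mulr_suml (hdec _ _ _).2 mul1r.
    rewrite sumr_const card_ord.
    over.
  rewrite sumr_const card_ord -mulrnA -[LHS]mulr_natr natrM.
  by field; rewrite !gt_eqF.
(* Encoder probabilities are at most 1, and the factor [M] undoes the uniform weight of the message
   in [Q]. *)
have hWQ xn zn yn : Wn xn zn yn <= M%:R * Q zn yn.
  rewrite mulr_sumr; apply: ler_sum => k _.
  rewrite mulr_sumr; apply: ler_sum => m _.
  have -> : M%:R * (dec m zn k yn / (M%:R * K%:R)) = dec m zn k yn / K%:R.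
    by field; rewrite !gt_eqF.
  rewrite ler_pM2r ?invr_gt0 // ler_piMl ?(hdec _ _ _).1 //.
  rewrite -(henc xn zn k).2 (bigD1 m) //= lerDl.
  by apply: sumr_ge0 => ? _; exact: (henc _ _ _).1.
have expE F : code_expect PXZ enc dec F =
    \sum_xn \sum_zn \sum_yn Jn PXZ Wn xn zn yn * F xn yn.
  apply: eq_bigr => xn _; apply: eq_bigr => zn _.
  under eq_bigr => k _ do rewrite exchange_big /=.
  rewrite exchange_big /=; apply: eq_bigr => yn _.
  rewrite /Jn /Wn mulr_sumr mulr_suml; apply: eq_bigr => k _.
  rewrite mulr_sumr mulr_suml; apply: eq_bigr => m _.
  by field; rewrite gt_eqF.
have hW := Wbar_channel hP n0 hWn.
exists (Wbar PXZ Wn); split => //.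
- exact: (single_letter_bound hP n0 hWn M0 hQ hWQ).
- by rewrite expE /exp_dist (sum_joint_Wbar hP n0 hWn (fun x _ y => D x y)).
- have J0 := Jn_ge0 hP hWn.
  apply: dTV_le => [|A].
    rewrite expE; do 3! (apply: sumr_ge0 => ? _).
    by rewrite mulr_ge0 ?J0 ?dTV_ge0.
  rewrite (sum_PX_setE _ hW) sum_PY_setE.
  rewrite (sum_joint_Wbar hP n0 hWn (fun x _ _ => (x \in A)%:R)).
  rewrite (sum_joint_Wbar hP n0 hWn (fun _ _ y => (y \in A)%:R)) expE.
  rewrite -sumrB; apply: le_trans (ler_norm_sum _ _ _) _; apply: ler_sum => xn _.
  rewrite -sumrB; apply: le_trans (ler_norm_sum _ _ _) _; apply: ler_sum => zn _.
  rewrite -sumrB; apply: le_trans (ler_norm_sum _ _ _) _; apply: ler_sum => yn _.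
  rewrite -mulrBr normrM ger0_norm ?J0 // ler_wpM2l ?J0 //.
  by rewrite -!sum_emp dTV_ge.
Qed.

Lemma achievable_channel (r r0 Delta Pi e : R) : 0 <= r0 -> 0 < e ->
  achievable_emp PXZ D r r0 Delta Pi ->
  exists W, [/\ channel W, cond_MI PXZ W <= r + e,
    exp_dist PXZ W D <= Delta + e & dTV (PX PXZ) (PY PXZ W) <= Pi + e].
Proof.
(* One block length suffices; the successor makes it positive. *)
move=> r00 e0 /(_ e e0)[N /(_ N.+1 (leqnSn N))] /=.
set M := card_of (pow2 _ (r + e)); set K := card_of (pow2 _ (r0 + e)) => -[enc [dec [hc [hD hT]]]].
have l2 : 0 < ln 2 :> R by rewrite ln_gt0 // ltr1n.
have p2 s : 0 < pow2 N.+1 s :> R by rewrite /pow2 powR_gt0.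
have K0 : (0 < K)%N.
  rewrite truncn_gt0; apply: pow2_ge1; apply: addr_ge0 => //; exact: ltW.
(* If [r + e] is negative the floor could be 0. But an encoder row over no messages cannot sum to 1,
   and source words exist because their law has mass 1. *)
have M0 : (0 < M)%N.
  have [M0|//] := posnP M; have /eqP := sum_Pn hP N.+1.
  rewrite big1 ?[0 == 1]eq_sym ?oner_eq0 // => xn _; apply: big1 => zn _.
  have /eqP := (hc.1 xn zn (Ordinal K0)).2.
  rewrite big1 ?[0 == 1]eq_sym ?oner_eq0 // => m _.
  by have := ltn_ord m; rewrite {2}M0.
have [W [hW hI hDW hTW]] := code_converse (ltn0Sn N) M0 K0 hc.
exists W; split=> //; [|by rewrite hDW | exact: le_trans hTW hT].
have nR : 0 < N.+1%:R :> R by rewrite ltr0n.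
rewrite -(ler_pM2l nR) -(ler_pM2r l2); apply: le_trans hI _.
rewrite -ln_powR ler_ln ?posrE ?ltr0n ?p2 //.
by rewrite truncn_le ltW // p2.
Qed.

End CodeConverse.

(** * Compactness of the set of channels *)

Section Compactness.
Local Open Scope classical_set_scope.

(** The point 0 is the delicate one. To its left the function vanishes, since [ln] is 0 on
    nonpositive reals. *)
Lemma xlnx_continuous (R : realType) : continuous (fun x : R => x * ln x).
Proof.
move=> x; have [x0|x0|->] := ltrgt0P x.
- exact: (@continuousM R R idfun (@ln R) x (@cvg_id _ _) (continuous_ln x0)).
- rewrite /continuous_at (ln0 (ltW x0)) mulr0.
  apply/cvgrPdist_lt => e e0; near=> t.
  have t0 : t < 0 by near: t; exact: lt_nbhsl.
  by rewrite (ln0 (ltW t0)) mulr0 subrr normr0.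
- rewrite /continuous_at mul0r.
  apply/cvgrPdist_lt => e e0; near=> t; rewrite sub0r normrN.
  have [t0|t0] := leP t 0; first by rewrite ln0 // mulr0 normr0.
  have t1 : t < 1 by near: t; apply: lt_nbhsl; exact: ltr01.
  (* Chosen so that [s = sqrt t] satisfies [s < e / 2]. Then [- ln s <= 1/s - 1] yields
     [- t ln t = 2 s^2 (- ln s) <= 2 s < e]. *)
  have te : t < (e / 2) ^+ 2.
    by near: t; apply: lt_nbhsl; rewrite exprn_gt0 // divr_gt0.
  set s := Num.sqrt t.
  have s0 : 0 < s by rewrite sqrtr_gt0.
  have ts : t = s ^+ 2 by rewrite sqr_sqrtr // ltW.
  have se : s < e / 2.
    by rewrite -(@ltr_pXn2r _ 2) ?nnegrE ?ltW ?divr_gt0 // -ts.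
  have lt0 : ln t <= 0 by apply: ln_le0; exact: ltW.
  rewrite ler0_norm; last by rewrite mulr_ge0_le0 // ltW.
  have ls : - ln s <= s^-1 - 1.
    rewrite -lnV ?posrE //.
    have := @le_ln1Dx R (s^-1 - 1); rewrite addrCA subrr addr0; apply.
    by rewrite ltrBrDr addNr invr_gt0.
  have -> : - (t * ln t) = s ^+ 2 * (- ln s) *+ 2.
    by rewrite ts expr2 lnM ?posrE // -mulr_natr; ring.
  apply: le_lt_trans (_ : s ^+ 2 * (s^-1 - 1) *+ 2 < _).
    by rewrite lerMn2r /= ler_wpM2l // sqr_ge0.
  have -> : s ^+ 2 * (s^-1 - 1) *+ 2 = 2 * s - 2 * s ^+ 2.
    by rewrite -mulr_natr; field; rewrite gt_eqF.
  have := sqr_ge0 s; lra.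
Unshelve. all: by end_near. Qed.

Lemma continuous_sum_fin (R : realType) (T : topologicalType) (I : finType)
    (P : pred I) (F : I -> T -> R) : (forall i, continuous (F i)) ->
  continuous (fun x => \sum_(i | P i) F i x).
Proof.
move=> hF; apply: (@continuous_big R I +%R 0 P) => [|i _]; last exact: hF.
exact: add_continuous.
Qed.

(** The nested sets [good e] generate a proper filter on a compact cube, and any cluster point will
    do. Testing with continuous [g] passes bounds to the limit without asking the sets [good e] to
    be closed. *)
Lemma unit_cube_cluster (R : realType) (N : nat) (good : R -> 'rV[R]_N -> Prop) :
  (forall e e' v, e <= e' -> good e v -> good e' v) ->
  (forall e v, good e v -> forall i, 0 <= v ord0 i <= 1) ->
  (forall e, 0 < e -> exists v, good e v) ->
  exists v, forall (g : 'rV[R]_N -> R) c, continuous g ->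
    (forall e w, 0 < e -> good e w -> g w <= c + e) -> g v <= c.
Proof.
move=> mono cube ex.
pose F := filter_from [set e : R | 0 < e] good.
have FF : ProperFilter F.
  apply: filter_from_proper; last by move=> e e0; exact: ex.
  apply: filter_from_filter; first by exists 1 => /=.
  move=> a b a0 b0; exists (Num.min a b) => /=; first by rewrite lt_min a0.
  by move=> v h; split; apply: mono h; rewrite ge_min lexx ?orbT.
have := @rV_compact R N (fun _ => `[0, 1]) (fun _ => @segment_compact R 0 1).
case/(_ F FF) => [|v [_ hv]].
  by exists 1 => //= v /cube h i /=; rewrite in_itv /= h.
exists v => g c cg hg; rewrite leNgt; apply/negP => cgv.
(* With half the gap, [g > c + e] on a neighbourhood of [v], which must meet [good e]. *)
pose e := (g v - c) / 2.
have e0 : 0 < e by rewrite divr_gt0 // subr_gt0.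
have : nbhs v [set w | c + e < g w].
  apply: (cg v [set y | c + e < y]); apply: lt_nbhsr.
  by rewrite /e; lra.
move=> /(hv (good e) _ (ex_intro2 _ _ e e0 (fun _ h => h))) [w [/(hg _ _ e0)]].
by rewrite leNgt => /negP.
Qed.

End Compactness.

Section RealContinuity.
Variables (R : realType) (T : topologicalType).
Implicit Types f g : T -> R.

Lemma continuous_mul f g :
  continuous f -> continuous g -> continuous (fun x => f x * g x).
Proof. by move=> cf cg x; exact: cvgM (cf x) (cg x). Qed.

Lemma continuous_add f g :
  continuous f -> continuous g -> continuous (fun x => f x + g x).
Proof. by move=> cf cg x; exact: cvgD (cf x) (cg x). Qed.

Lemma continuous_opp f : continuous f -> continuous (fun x => - f x).
Proof. by move=> cf x; exact: cvgN (cf x). Qed.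

Lemma continuous_xlnx f : continuous f -> continuous (fun x => f x * ln (f x)).
Proof.
by move=> cf x; exact: continuous_comp (cf x) (@xlnx_continuous R (f x)).
Qed.

End RealContinuity.

(** * Closedness of the single-letter constraints *)

Section InfoClosed.
Variables (R : realType) (X Z : finType) (PXZ : X -> Z -> R) (D : X -> X -> R).
Hypothesis hP : is_pmf (fun xz : X * Z => PXZ xz.1 xz.2).

(** The quotient in [dens] is not continuous where [PYZ] vanishes. Here only [x ln x] terms and
    terms linear in [W] occur, the logarithms of [PXZ] and [PZ] being constants. *)
Lemma cond_MI_xlnx W : channel W -> cond_MI PXZ W =
  (\sum_x \sum_z \sum_y (joint PXZ W x z y * ln (joint PXZ W x z y) +
     joint PXZ W x z y * (ln (PZ PXZ z) - ln (PXZ x z))) -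
   \sum_y \sum_z PYZ PXZ W y z * ln (PYZ PXZ W y z)) / ln 2.
Proof.
move=> hW; rewrite cond_MIE; congr (_ / _).
have -> : \sum_y \sum_z PYZ PXZ W y z * ln (PYZ PXZ W y z) =
    \sum_x \sum_z \sum_y joint PXZ W x z y * ln (PYZ PXZ W y z).
  rewrite exchange_big [RHS]exchange_big /=; apply: eq_bigr => z _.
  rewrite [RHS]exchange_big /=; apply: eq_bigr => y _.
  by rewrite -mulr_suml.
rewrite -sumrB; apply: eq_bigr => x _; rewrite -sumrB; apply: eq_bigr => z _.
rewrite -sumrB; apply: eq_bigr => y _.
have := joint_ge0 hP x z y hW; rewrite le_eqVlt => /predU1P[<-|j0].
  by rewrite !mul0r addr0 subr0.
have [p0 pz0 py0] := joint_gt0_marg hP hW j0.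
rewrite /dens (ln_div (mulr_gt0 j0 pz0) (mulr_gt0 p0 py0)) (lnM j0 pz0) (lnM p0 py0).
by ring.
Qed.

Let N := #|{: X * Z * X}|.

(** Coordinates that place the channels inside a unit cube of row vectors, where compactness
    applies. *)
Definition chan_of_row (v : 'rV[R]_N) (x : X) (z : Z) (y : X) : R :=
  v ord0 (enum_rank (x, z, y)).

Lemma chan_of_row_continuous x z y : continuous (fun v => chan_of_row v x z y).
Proof. exact: coord_continuous. Qed.

Lemma joint_continuous x z y :
  continuous (fun v => joint PXZ (chan_of_row v) x z y).
Proof.
by apply: continuous_mul; [exact: cst_continuous | exact: chan_of_row_continuous].
Qed.

Lemma PYZ_continuous y z : continuous (fun v => PYZ PXZ (chan_of_row v) y z).
Proof. by apply: continuous_sum_fin => x; exact: joint_continuous. Qed.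

Lemma PY_continuous y : continuous (fun v => PY PXZ (chan_of_row v) y).
Proof.
by apply: continuous_sum_fin => x; apply: continuous_sum_fin => z; exact: joint_continuous.
Qed.

Lemma exp_dist_continuous : continuous (fun v => exp_dist PXZ (chan_of_row v) D).
Proof.
do 3! (apply: continuous_sum_fin => ?).
by apply: continuous_mul; [exact: joint_continuous | exact: cst_continuous].
Qed.

Lemma info_continuous : continuous (fun v => let W := chan_of_row v in
  (\sum_x \sum_z \sum_y (joint PXZ W x z y * ln (joint PXZ W x z y) +
     joint PXZ W x z y * (ln (PZ PXZ z) - ln (PXZ x z))) -
   \sum_y \sum_z PYZ PXZ W y z * ln (PYZ PXZ W y z)) / ln 2).
Proof.
apply: continuous_mul; last exact: cst_continuous.
apply: continuous_add.
  apply: continuous_sum_fin => x; apply: continuous_sum_fin => z.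
  apply: continuous_sum_fin => y; apply: continuous_add.
    by apply: continuous_xlnx; exact: joint_continuous.
  by apply: continuous_mul; [exact: joint_continuous | exact: cst_continuous].
apply: continuous_opp; apply: continuous_sum_fin => y; apply: continuous_sum_fin => z.
apply: (@continuous_xlnx _ _ (fun v => PYZ PXZ (chan_of_row v) y z)).
exact: PYZ_continuous.
Qed.

(** Every requirement on [W] is a family of inequalities [g W <= c] with [g] continuous, so each
    survives at the cluster point. *)
Lemma feasible_limit (r Delta Pi : R) :
  (forall e, 0 < e -> exists W, [/\ channel W, cond_MI PXZ W <= r + e,
     exp_dist PXZ W D <= Delta + e & dTV (PX PXZ) (PY PXZ W) <= Pi + e]) ->
  exists W, [/\ channel W, cond_MI PXZ W <= r,
     exp_dist PXZ W D <= Delta & dTV (PX PXZ) (PY PXZ W) <= Pi].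
Proof.
move=> hex.
pose good e v := let W := chan_of_row v in
  [/\ channel W, cond_MI PXZ W <= r + e,
     exp_dist PXZ W D <= Delta + e & dTV (PX PXZ) (PY PXZ W) <= Pi + e].
have [||e e0|v hv] := @unit_cube_cluster R N good.
- by move=> e e' v ee [h1 h2 h3 h4]; split=> //;
    [apply: le_trans h2 _ | apply: le_trans h3 _ | apply: le_trans h4 _];
    rewrite lerD2l.
- move=> e v [hW _ _ _] i.
  have := hW (enum_val i).1.1 (enum_val i).1.2.
  have -> : v ord0 i = chan_of_row v (enum_val i).1.1 (enum_val i).1.2 (enum_val i).2.
    by rewrite /chan_of_row -!surjective_pairing enum_valK.
  move=> [w0 w1]; rewrite w0 -w1 (bigD1 (enum_val i).2) //= lerDl.
  by apply: sumr_ge0 => *; exact: w0.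
- have [W hW] := hex e e0.
  exists (\row_i W (enum_val i).1.1 (enum_val i).1.2 (enum_val i).2).
  rewrite /good (_ : chan_of_row _ = W) //.
  by do 3! (apply/funext => ?); rewrite /chan_of_row mxE enum_rankK.
(* Nonnegativity is tested through [- W <= 0], and the row sum through two opposite inequalities. *)
have hc : channel (chan_of_row v).
  move=> x z; split=> [y|].
    rewrite -oppr_le0; apply: (hv (fun v => - chan_of_row v x z y)).
      by apply: continuous_opp; exact: chan_of_row_continuous.
    move=> e w e0 [hW _ _ _]; rewrite add0r.
    by apply: le_trans (ltW e0); rewrite oppr_le0 (hW _ _).1.
  have cs : continuous (fun v => \sum_y chan_of_row v x z y).
    by apply: continuous_sum_fin => y; exact: chan_of_row_continuous.
  apply/eqP; rewrite eq_le; apply/andP; split.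
    apply: (hv (fun v => \sum_y chan_of_row v x z y)) => // e w e0 [hW _ _ _].
    by rewrite (hW _ _).2 lerDl ltW.
  rewrite -lerN2; apply: (hv (fun v => - \sum_y chan_of_row v x z y)).
    exact: continuous_opp cs.
  by move=> e w e0 [hW _ _ _]; rewrite (hW _ _).2 lerDl ltW.
exists (chan_of_row v); split=> //.
- rewrite cond_MI_xlnx //.
  apply: (hv _ _ info_continuous) => e w e0 [hW hI _ _].
  by rewrite /= -cond_MI_xlnx.
- by apply: (hv _ _ exp_dist_continuous) => e w e0 [].
- apply: dTV_le => [|A].
    (* The bound [0 <= Pi] comes from the constant test function, as [dTV] is nonnegative for every
       slack. *)
    apply: (hv (fun=> 0)) => [|e w e0 [_ _ _]]; first exact: cst_continuous.
    exact: le_trans (dTV_ge0 _ _).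
  have cA : continuous (fun v => \sum_(t in A) PX PXZ t -
      \sum_(t in A) PY PXZ (chan_of_row v) t).
    apply: continuous_add; first exact: cst_continuous.
    by apply: continuous_opp; apply: continuous_sum_fin => t; exact: PY_continuous.
  apply: (hv (fun v => `|\sum_(t in A) PX PXZ t -
    \sum_(t in A) PY PXZ (chan_of_row v) t|)).
    by move=> w; exact: cvg_norm (cA w).
  by move=> e w e0 [_ _ _]; apply: le_trans; exact: dTV_ge.
Qed.

End InfoClosed.

(** * Achievability *)

Section TotalVariation.
Variables (R : realType) (T : finType).
Implicit Types P Q S : T -> R.

Lemma dTV_sym P Q : dTV P Q = dTV Q P.
Proof. by apply: eq_bigr => A _; rewrite distrC. Qed.

Lemma dTV_triangle P Q S : dTV P S <= dTV P Q + dTV Q S.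
Proof.
apply: dTV_le => [|A]; first by rewrite addr_ge0 ?dTV_ge0.
by apply: le_trans (ler_distD (\sum_(t in A) Q t) _ _) _; rewrite lerD ?dTV_ge.
Qed.

Lemma dTV_le_card P Q d : 0 <= d -> (forall t, `|P t - Q t| <= d) ->
  dTV P Q <= #|T|%:R * d.
Proof.
move=> d0 h; apply: dTV_le => [|A]; first by rewrite mulr_ge0.
rewrite -sumrB; apply: le_trans (ler_norm_sum _ _ _) _.
apply: le_trans (_ : \sum_(t in A) d <= _); first by apply: ler_sum.
by rewrite sumr_const -[leLHS]mulr_natl ler_wpM2r // ler_nat max_card.
Qed.

Lemma dTV_emp_le1 n (xn yn : word T n) : dTV (emp R xn) (emp R yn) <= 1.
Proof.
have h (wn : word T n) (A : {set T}) : 0 <= \sum_(t in A) emp R wn t <= 1.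
  rewrite sum_emp divr_ge0 ?sumr_ge0 //=.
  have [n0|n0] := posnP n; first by rewrite [X in _ / X%:R]n0 invr0 mulr0.
  rewrite ler_pdivrMr ?ltr0n // mul1r -[X in _ <= X%:R](card_ord n) -sum1_card natr_sum.
  by apply: ler_sum => i _; case: (_ \in _).
apply: dTV_le => // A; have := h xn A; have := h yn A.
by rewrite ler_norml; lra.
Qed.

End TotalVariation.

Section Achievability.
Variables (R : realType) (X Z : finType) (PXZ : X -> Z -> R) (D : X -> X -> R).
Hypothesis hP : is_pmf (fun xz : X * Z => PXZ xz.1 xz.2).
Variable W : X -> Z -> X -> R.
Hypothesis hW : channel W.

Let A := (X * Z * X)%type.

Definition jt (a : A) : R := joint PXZ W a.1.1 a.1.2 a.2.

Lemma jt_pmf : is_pmf jt.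
Proof.
split=> [a|]; first exact: joint_ge0.
by rewrite -(sum_triple (joint PXZ W)) sum_joint3.
Qed.

Definition zip3 n (xn : word X n) (zn : word Z n) (yn : word X n) : word A n :=
  [ffun i => (xn i, zn i, yn i)].

Lemma sum_zip3 n (G : word A n -> R) :
  \sum_w G w = \sum_xn \sum_zn \sum_yn G (zip3 xn zn yn).
Proof.
rewrite (sum_triple (fun xn zn yn => G (zip3 xn zn yn))).
rewrite (reindex (fun u : word X n * word Z n * word X n =>
  zip3 u.1.1 u.1.2 u.2)) //=.
exists (fun w : word A n =>
  ([ffun i => (w i).1.1], [ffun i => (w i).1.2], [ffun i => (w i).2])) => /=.
  by move=> [[a b] c] _ /=; congr (_, _, _); apply/ffunP => i; rewrite !ffunE.
by move=> w _; apply/ffunP => i; rewrite !ffunE /=; case: (w i) => [[]].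
Qed.

Lemma iid_zip3 n (xn : word X n) (zn : word Z n) (yn : word X n) :
  iid jt (zip3 xn zn yn) = Pn PXZ xn zn * \prod_i W (xn i) (zn i) (yn i).
Proof. by rewrite -big_split; apply: eq_bigr => i _; rewrite ffunE. Qed.

(** Distortion, log-density and the letter indicators of source and reproduction, gathered under one
    finite index so that a single call of [weak_law] controls them all. *)
Definition stat (j : option X * bool) (a : A) : R :=
  match j with
  | (None, true) => D a.1.1 a.2
  | (None, false) => ln (dens PXZ W a.1.1 a.1.2 a.2)
  | (Some x, true) => (a.1.1 == x)%:R
  | (Some x, false) => (a.2 == x)%:R
  end.

Definition typical (d : R) n (w : word A n) : bool :=
  ~~ [exists j, n%:R * d < `|\sum_(i < n) stat j (w i) - n%:R * \sum_a jt a * stat j a|].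

Lemma typical_mean d n (w : word A n) j : (0 < n)%N -> typical d w ->
  `|(\sum_(i < n) stat j (w i)) / n%:R - \sum_a jt a * stat j a| <= d.
Proof.
move=> n0; rewrite /typical negb_exists => /forallP/(_ j); rewrite -leNgt => h.
have nR : 0 < n%:R :> R by rewrite ltr0n.
rewrite -(ler_pM2l nR); apply: le_trans h.
rewrite -{1}[n%:R]gtr0_norm // -normrM mulrBr mulrC divfK ?gt_eqF //.
Qed.

Section Typical.
Variables (d : R) (n : nat) (xn : word X n) (zn : word Z n) (yn : word X n).
Hypotheses (d0 : 0 <= d) (n0 : (0 < n)%N) (ht : typical d (zip3 xn zn yn)).

Lemma typical_dist : Dn D xn yn <= exp_dist PXZ W D + d.
Proof.
have := typical_mean (None, true) n0 ht.
rewrite /exp_dist (sum_triple (fun x z y => joint PXZ W x z y * D x y)).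
move=> /(le_trans (ler_norm _)); rewrite lerBlDl /=.
by under eq_bigr do rewrite ffunE.
Qed.

Lemma typical_dens :
  \sum_i ln (dens PXZ W (xn i) (zn i) (yn i)) <= n%:R * (cond_MI PXZ W * ln 2 + d).
Proof.
have nR : 0 < n%:R :> R by rewrite ltr0n.
have := typical_mean (None, false) n0 ht.
rewrite cond_MIE divfK ?gt_eqF ?ln_gt0 ?ltr1n //.
rewrite (sum_triple (fun x z y => joint PXZ W x z y * ln (dens PXZ W x z y))).
move=> /(le_trans (ler_norm _)); rewrite lerBlDl /= ler_pdivrMr // mulrC.
by under eq_bigr do rewrite ffunE.
Qed.

Lemma typical_empX : dTV (emp R xn) (PX PXZ) <= #|X|%:R * d.
Proof.
apply: dTV_le_card => // x.
have := typical_mean (Some x, true) n0 ht; rewrite /=.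
rewrite -(sum_triple (fun a b c => joint PXZ W a b c * (a == x)%:R)).
under eq_bigr do rewrite ffunE /=.
have := sum_PX_setE PXZ (finset.set1 x) hW; rewrite big_set1 => ->.
have := sum_emp R xn (finset.set1 x); rewrite big_set1 => ->.
under [X in _ -> `|X / _ - _| <= _]eq_bigr do rewrite finset.in_set1.
by under [X in _ -> `|_ - X| <= _]eq_bigr do
  under eq_bigr do under eq_bigr do rewrite finset.in_set1.
Qed.

Lemma typical_empY : dTV (PY PXZ W) (emp R yn) <= #|X|%:R * d.
Proof.
rewrite dTV_sym; apply: dTV_le_card => // x.
have := typical_mean (Some x, false) n0 ht; rewrite /=.
rewrite -(sum_triple (fun a b c => joint PXZ W a b c * (c == x)%:R)).
under eq_bigr do rewrite ffunE /=.
have := sum_PY_setE PXZ W (finset.set1 x); rewrite big_set1 => ->.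
have := sum_emp R yn (finset.set1 x); rewrite big_set1 => ->.
under [X in _ -> `|X / _ - _| <= _]eq_bigr do rewrite finset.in_set1.
by under [X in _ -> `|_ - X| <= _]eq_bigr do
  under eq_bigr do under eq_bigr do rewrite finset.in_set1.
Qed.

Lemma typical_dTV :
  dTV (emp R xn) (emp R yn) <= dTV (PX PXZ) (PY PXZ W) + #|X|%:R * d *+ 2.
Proof.
apply: le_trans (dTV_triangle _ (PX PXZ) _) _.
have h := dTV_triangle (PX PXZ) (PY PXZ W) (emp R yn).
have hx := typical_empX; have hy := typical_empY.
by rewrite mulr2n; lra.
Qed.

End Typical.
End Achievability.

(** * Covering with side information *)

Section Covering.
Variables (R : realType) (X Z : finType) (PXZ : X -> Z -> R) (D : X -> X -> R).
Hypothesis hP : is_pmf (fun xz : X * Z => PXZ xz.1 xz.2).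
Variable W : X -> Z -> X -> R.
Hypothesis hW : channel W.
Variable x0 : X.

(* The value where [PZ z = 0] is arbitrary; [x0] only makes it a pmf. *)
Definition output_law z y : R :=
  if PZ PXZ z == 0 then (y == x0)%:R else PYZ PXZ W y z / PZ PXZ z.

Lemma output_law_pmf z : is_pmf (output_law z).
Proof.
rewrite /output_law; case: eqP => [_|/eqP pz]; split=> [y|].
- by [].
- by rewrite (bigD1 x0) //= eqxx big1 ?addr0 // => y /negbTE ->.
- by rewrite divr_ge0 ?(PYZ_ge0 hP _ _ hW) ?(PZ_ge0 hP).
- by rewrite -mulr_suml sum_PYZ // divff.
Qed.

(** On the support, [dens] is the likelihood ratio of the channel to the output law. *)
Lemma channel_dens x z y : 0 < joint PXZ W x z y ->
  W x z y = output_law z y * dens PXZ W x z y.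
Proof.
move=> j0; have [p0 pz py] := joint_gt0_marg hP hW j0.
rewrite /output_law gt_eqF // /dens {1}/joint.
by field; rewrite !gt_eqF.
Qed.

Definition output_word n (zn : word Z n) (yn : word X n) : R :=
  \prod_i output_law (zn i) (yn i).

Lemma output_word_pmf n (zn : word Z n) : is_pmf (output_word zn).
Proof.
split=> [yn|]; first by apply: prodr_ge0 => i _; exact: (output_law_pmf _).1.
rewrite -(bigA_distr_bigA (fun i y => output_law (zn i) y)) big1 // => i _.
exact: (output_law_pmf _).2.
Qed.

Definition chan_word n (xn : word X n) (zn : word Z n) (yn : word X n) : R :=
  \prod_i W (xn i) (zn i) (yn i).

Lemma chan_word_pmf n (xn : word X n) (zn : word Z n) : is_pmf (chan_word xn zn).
Proof.
split=> [yn|]; first by apply: prodr_ge0 => i _; exact: (hW _ _).1.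
rewrite -(bigA_distr_bigA (fun i y => W (xn i) (zn i) y)) big1 // => i _.
exact: (hW _ _).2.
Qed.

(** Positivity is required besides typicality: off the support [dens] is 0 and [ln 0 = 0], so the
    log-density statistic would say nothing about the likelihood ratio. Only words of probability
    zero are discarded. *)
Definition good d n (xn : word X n) (zn : word Z n) (yn : word X n) : bool :=
  typical PXZ D W d (zip3 xn zn yn) && (0 < iid (jt PXZ W) (zip3 xn zn yn)).

(** A change of measure: the ratio of the two word laws is the product of the densities, bounded
    through the log-density statistic. *)
Lemma good_density d n (xn : word X n) (zn : word Z n) (yn : word X n) :
  (0 < n)%N -> good d xn zn yn ->
  expR (- (n%:R * (cond_MI PXZ W * ln 2 + d))) * chan_word xn zn yn <=
  output_word zn yn.
Proof.
move=> n0 /andP[ht hpos].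
have letter i : 0 < joint PXZ W (xn i) (zn i) (yn i).
  rewrite lt_def joint_ge0 // andbT; apply: contraTneq hpos => h.
  by rewrite /iid (bigD1 i) //= ffunE /jt /= h mul0r ltxx.
have -> : chan_word xn zn yn = output_word zn yn *
    expR (\sum_i ln (dens PXZ W (xn i) (zn i) (yn i))).
  rewrite expR_sum -big_split; apply: eq_bigr => i _ /=.
  by rewrite lnK ?posrE ?dens_gt0 // -channel_dens.
rewrite mulrCA -expRD ler_piMr ?(output_word_pmf _).1 //.
rewrite -[leRHS]expR0 ler_expR addrC subr_le0.
exact: typical_dens n0 ht.
Qed.

Lemma good_codebook d n M (zn : word Z n) : (0 < n)%N -> (0 < M)%N ->
  exists c : word (word X n) M,
    \sum_xn Pn PXZ xn zn * (~~ [exists m, good d xn zn (c m)])%:R <=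
    \sum_xn \sum_yn iid (jt PXZ W) (zip3 xn zn yn) *
        (~~ typical PXZ D W d (zip3 xn zn yn))%:R +
    \sum_xn Pn PXZ xn zn *
      (expR (- (n%:R * (cond_MI PXZ W * ln 2 + d))) * M%:R)^-1.
Proof.
move=> n0 M0; set b := expR _.
have [c hc] := random_codebook (fun xn => Pn PXZ xn zn)
  (fun xn yn => good d xn zn yn) M (output_word_pmf zn).
exists c; apply: le_trans hc _; rewrite -big_split /=.
apply: ler_sum => xn _.
pose a := \sum_yn chan_word xn zn yn * (good d xn zn yn)%:R.
have a01 : 0 <= a <= 1.
  rewrite sumr_ge0 => [|yn _]; last by rewrite mulr_ge0 ?(chan_word_pmf _ _).1.
  rewrite -[leRHS](chan_word_pmf xn zn).2; apply: ler_sum => yn _.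
  by rewrite ler_piMr ?(chan_word_pmf _ _).1 ?lern1 ?leq_b1.
have ba : b * a <= \sum_yn output_word zn yn * (good d xn zn yn)%:R.
  rewrite mulr_sumr; apply: ler_sum => yn _; rewrite mulrA.
  case: (boolP (good d xn zn yn)) => h; last by rewrite !mulr0.
  by rewrite !mulr1; exact: good_density.
have q1 : \sum_yn output_word zn yn * (good d xn zn yn)%:R <= 1.
  rewrite -[leRHS](output_word_pmf zn).2; apply: ler_sum => yn _.
  by rewrite ler_piMr ?(output_word_pmf _).1 ?lern1 ?leq_b1.
apply: le_trans (_ : Pn PXZ xn zn * (1 - a + (b * M%:R)^-1) <= _).
  rewrite ler_wpM2l ?(Pn_ge0 hP) //.
  by apply: miss_probability_le; rewrite ?expR_gt0.
(* [1 - a] is the channel mass of the words that are not good; those failing only positivity weigh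
   nothing, which leaves the atypical ones. *)
rewrite mulrDr lerD2r -[X in X - a](chan_word_pmf xn zn).2 -sumrB mulr_sumr.
apply: ler_sum => yn _; rewrite iid_zip3 -/(chan_word xn zn yn).
rewrite /good iid_zip3 -/(chan_word xn zn yn).
case: (typical _ _ _ _ _) => /=; last by rewrite mulr0 subr0 mulr1.
case: ltP => h; first by rewrite mulr1 subrr !mulr0.
by rewrite !mulr0 subr0.
Qed.

End Covering.

(** * Deterministic codes from codebooks *)

Section CodebookCode.
Variables (R : realType) (X Z : finType) (PXZ : X -> Z -> R).
Variables (n M K : nat) (c : word Z n -> word (word X n) M).
Variable sel : word X n -> word Z n -> 'I_M.

Definition book_enc (xn : word X n) (zn : word Z n) (_ : 'I_K) (m : 'I_M) : R :=
  (m == sel xn zn)%:R.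

Definition book_dec (m : 'I_M) (zn : word Z n) (_ : 'I_K) (yn : word X n) : R :=
  (yn == c zn m)%:R.

Lemma sum_delta (T : finType) (t : T) (f : T -> R) :
  \sum_s (s == t)%:R * f s = f t.
Proof.
rewrite (bigD1 t) //= eqxx mul1r big1 ?addr0 // => s /negbTE ->.
by rewrite mul0r.
Qed.

Lemma book_valid : valid_code book_enc book_dec.
Proof.
split=> [xn zn k|m zn k]; split=> //.
  rewrite -[RHS](sum_delta (sel xn zn) (fun=> 1)).
  by apply: eq_bigr => m _; rewrite mulr1.
rewrite -[RHS](sum_delta (c zn m) (fun=> 1)).
by apply: eq_bigr => yn _; rewrite mulr1.
Qed.

Lemma book_expect F : (0 < K)%N ->
  code_expect PXZ book_enc book_dec F =
  \sum_zn \sum_xn Pn PXZ xn zn * F xn (c zn (sel xn zn)).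
Proof.
move=> K0; have KR : K%:R != 0 :> R by rewrite pnatr_eq0 -lt0n.
rewrite /code_expect exchange_big /=; apply: eq_bigr => zn _; apply: eq_bigr => xn _.
transitivity (\sum_(k < K) Pn PXZ xn zn / K%:R * F xn (c zn (sel xn zn))).
  apply: eq_bigr => k _.
  rewrite -[RHS](sum_delta (sel xn zn) (fun m => Pn PXZ xn zn / K%:R * F xn (c zn m))).
  apply: eq_bigr => m _.
  rewrite -(sum_delta (c zn m) (fun yn => Pn PXZ xn zn / K%:R * F xn yn)) mulr_sumr.
  by apply: eq_bigr => yn _; rewrite /book_enc /book_dec; ring.
by rewrite sumr_const card_ord -mulr_natl; field.
Qed.

End CodebookCode.

(** * Error analysis and choice of parameters *)

Section Achieve.
Variables (R : realType) (X Z : finType) (PXZ : X -> Z -> R) (D : X -> X -> R).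
Hypothesis hP : is_pmf (fun xz : X * Z => PXZ xz.1 xz.2).
Variable W : X -> Z -> X -> R.
Hypothesis hW : channel W.

(** The code is chosen before [F], so the same one meets the distortion and the perception
    constraint. *)
Lemma good_code d n M K : (0 < n)%N -> (0 < M)%N -> (0 < K)%N ->
  exists enc dec, @valid_code R X Z n M K enc dec /\
  forall (F : word X n -> word X n -> R) (c0 B : R), 0 <= c0 -> 0 <= B ->
    (forall xn yn, F xn yn <= B) ->
    (forall xn zn yn, typical PXZ D W d (zip3 xn zn yn) -> F xn yn <= c0) ->
    code_expect PXZ enc dec F <= c0 + B *
      (\sum_(w : word (X * Z * X)%type n) iid (jt PXZ W) w * (~~ typical PXZ D W d w)%:R +
       (expR (- (n%:R * (cond_MI PXZ W * ln 2 + d))) * M%:R)^-1).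
Proof.
move=> n0 M0 K0.
have [[x0 z0] _] : exists xz : X * Z, True.
  apply/not_existsP => h; have /eqP := hP.2.
  by rewrite big1 ?[0 == 1]eq_sym ?oner_eq0 // => xz; case: (h xz).
have [c hc] := choice (fun zn => good_codebook D hP hW x0 d zn n0 M0).
(* On a miss an arbitrary index is sent; the cost is then bounded by [B]. *)
pose sel xn zn : 'I_M := odflt (Ordinal M0) [pick m | good PXZ D W d xn zn (c zn m)].
exists (@book_enc R X Z n M K sel), (@book_dec R X Z n M K c); split=> [|F c0 B c00 B0 hB hF].
  exact: book_valid.
rewrite book_expect //; set b := expR _.
apply: le_trans (_ : \sum_zn \sum_xn (c0 * Pn PXZ xn zn + B * (Pn PXZ xn zn *
    (~~ [exists m, good PXZ D W d xn zn (c zn m)])%:R)) <= _).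
  apply: ler_sum => zn _; apply: ler_sum => xn _.
  have p0 := Pn_ge0 hP xn zn.
  rewrite /sel; case: pickP => [m hm|hm] /=.
    rewrite mulrC -[leLHS]addr0 lerD ?mulr_ge0 // ler_wpM2r //.
    by case/andP: hm => ht _; exact: hF ht.
  rewrite (introN existsP) => [|[m]]; last by rewrite hm.
  by rewrite mulr1 mulrC -[leLHS]add0r lerD ?mulr_ge0 // ler_wpM2r.
under eq_bigr do rewrite big_split -!mulr_sumr /=.
rewrite big_split -!mulr_sumr /=; apply: lerD.
  by rewrite exchange_big /= sum_Pn // mulr1.
rewrite ler_wpM2l //.
apply: le_trans (ler_sum _ (fun zn _ => hc zn)) _.
rewrite big_split /= lerD //.
  rewrite (sum_zip3 (fun w : word (X * Z * X)%type n => iid (jt PXZ W) w * (~~ typical PXZ D W d w)%:R)).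
  by rewrite exchange_big.
under eq_bigr do rewrite -mulr_suml.
by rewrite -mulr_suml exchange_big /= sum_Pn // mul1r.
Qed.

Lemma cond_MI_achievable (dmax Delta Pi : R) :
  (forall x y, 0 <= D x y <= dmax) ->
  exp_dist PXZ W D <= Delta -> dTV (PX PXZ) (PY PXZ W) <= Pi ->
  achievable_emp PXZ D (cond_MI PXZ W) 0 Delta Pi.
Proof.
move=> hD hDelta hPi e e0.
have l2 : 0 < ln 2 :> R by rewrite ln_gt0 // ltr1n.
have l21 : ln 2 <= 1 :> R by apply: (@le_ln1Dx R 1); rewrite (lt_trans _ ltr01) // oppr_lt0.
have I0 := cond_MI_ge0 hP hW.
have E0 : 0 <= exp_dist PXZ W D.
  apply: sumr_ge0 => x _; apply: sumr_ge0 => z _; apply: sumr_ge0 => y _.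
  by rewrite mulr_ge0 ?joint_ge0 //; case/andP: (hD x y).
have T0 := dTV_ge0 (PX PXZ) (PY PXZ W).
pose c1 : R := #|X|%:R + 1.
have c1_gt0 : 0 < c1 by rewrite ltr_wpDl.
have c1_ge1 : 1 <= c1 by rewrite lerDr.
(* Small enough that the letter frequencies cost [2 |X| d <= e / 2] and that the rate margin
   [e ln 2 - d] is at least [theta = e ln 2 / 2]. *)
pose d := e * ln 2 / (4 * c1).
have d0 : 0 < d by rewrite divr_gt0 // mulr_gt0.
have dc1 : d * c1 = e * ln 2 / 4 by rewrite /d; field; rewrite gt_eqF.
have d_le : d <= e * ln 2 / 4 by rewrite -dc1 ler_peMr // ltW.
have e_le : e * ln 2 <= e by rewrite ler_piMr // ltW.
have d_e2 : d <= e / 2 by lra.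
have Xd : #|X|%:R * d *+ 2 <= e / 2.
  have : #|X|%:R * d <= d * c1 by rewrite mulrC ler_wpM2l ?ltW // ltrDl.
  by rewrite dc1 => h; rewrite -[leLHS]mulr_natr; lra.
(* A common bound for the distortion, at most [dmax], and the total variation, at most 1. *)
pose B := Num.max dmax 1; have B1 : 1 <= B by rewrite le_max lexx orbT.
have B0 : 0 < B by exact: lt_le_trans ltr01 B1.
(* Atypicality and covering failure each contribute at most [eta], and [B (eta + eta) = e / 2]. *)
pose eta := e / (4 * B); have eta0 : 0 < eta by rewrite divr_gt0 // mulr_gt0.
pose theta := e * ln 2 / 2; have theta0 : 0 < theta by rewrite divr_gt0 // mulr_gt0.
have [N1 hN1] := weak_law (stat PXZ D W) (jt_pmf hP hW) d0 eta0.
pose N2 := (Num.truncn (2 / theta / eta)).+1.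
exists (maxn 1 (maxn N1 N2)) => n; rewrite !geq_max => /and3P[n0 nN1 nN2].
set M := card_of _; set K := card_of _.
have nR : 0 < n%:R :> R by rewrite ltr0n.
have p1 : 1 <= pow2 n (cond_MI PXZ W + e) by rewrite pow2_ge1 // addr_ge0 // ltW.
have M0 : (0 < M)%N by rewrite truncn_gt0.
have K0 : (0 < K)%N by rewrite truncn_gt0 pow2_ge1 // add0r ltW.
have MR : 1 <= M%:R :> R by rewrite ler1n.
(* Since [M >= 1], taking the floor loses at most a factor 2. *)
have hM : pow2 n (cond_MI PXZ W + e) <= 2 * M%:R.
  have := truncnS_gt (pow2 n (cond_MI PXZ W + e)); rewrite -/(card_of _) -/M -natr1.
  lra.
have [enc [dec [hc hF]]] := good_code d n0 M0 K0.
set b := expR _ in hF.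
have b0 : 0 < b by exact: expR_gt0.
(* The linear lower bound on the exponential is enough: [b M] only has to tend to infinity. *)
have bM : n%:R * theta <= 2 * (b * M%:R).
  apply: le_trans (_ : b * pow2 n (cond_MI PXZ W + e) <= _); last first.
    by rewrite mulrCA ler_pM2l.
  rewrite /pow2 /powR pnatr_eq0 /= -expRD.
  apply: le_trans (_ : expR (n%:R * theta) <= _).
    by apply: le_trans (expR_ge1Dx _); rewrite lerDr.
  rewrite ler_expR.
  have -> : - (n%:R * (cond_MI PXZ W * ln 2 + d)) + n%:R * (cond_MI PXZ W + e) * ln 2 =
     n%:R * (e * ln 2 - d) by ring.
  rewrite ler_pM2l // /theta; lra.
have hbM : (b * M%:R)^-1 <= eta.
  have bM0 : 0 < b * M%:R by rewrite mulr_gt0 // (lt_le_trans ltr01).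
  rewrite -[leLHS]mul1r ler_pdivrMr //.
  have : 2 / theta / eta <= n%:R.
    by apply: ltW; apply: lt_le_trans (truncnS_gt _) _; rewrite ler_nat.
  rewrite !ler_pdivrMr // => h.
  have : eta * (n%:R * theta) <= eta * (2 * (b * M%:R)) by rewrite ler_pM2l.
  lra.
have herr : B * (\sum_(w : word (X * Z * X)%type n) iid (jt PXZ W) w * (~~ typical PXZ D W d w)%:R +
    (b * M%:R)^-1) <= e / 2.
  apply: le_trans (_ : B * (eta + eta) <= _).
    rewrite ler_pM2l // lerD //; apply: le_trans (hN1 n nN1).
    by apply: ler_sum => w _; rewrite /typical negbK.
  by rewrite le_eqVlt; apply/orP; left; apply/eqP; rewrite /eta; field; rewrite gt_eqF.
exists enc, dec; split=> //; split.
  apply: le_trans (hF _ (exp_dist PXZ W D + d) B _ _ _ _) _.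
  - by rewrite addr_ge0 // ltW.
  - exact: ltW.
  - move=> xn yn; rewrite /Dn ler_pdivrMr //.
    apply: le_trans (_ : \sum_(i < n) B <= _).
      by apply: ler_sum => i _; rewrite le_max; case/andP: (hD (xn i) (yn i)) => _ ->.
    by rewrite sumr_const card_ord -[leLHS]mulr_natr.
  - move=> xn zn yn ht; exact: typical_dist n0 ht.
  - lra.
apply: le_trans (hF _ (dTV (PX PXZ) (PY PXZ W) + #|X|%:R * d *+ 2) B _ _ _ _) _.
- by rewrite addr_ge0 // mulrn_wge0 // mulr_ge0 // ltW.
- exact: ltW.
- by move=> xn yn; apply: le_trans (dTV_emp_le1 R xn yn) B1.
- by move=> xn zn yn ht; exact: (typical_dTV hW (ltW d0) n0 ht).
- lra.
Qed.

End Achieve.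

Theorem theorem3 (R : realType) (X Z : finType) (PXZ : X -> Z -> R)
  (D : X -> X -> R) (dmax : R)
  (hP : is_pmf (fun xz : X * Z => PXZ xz.1 xz.2))
  (hD : forall x y, 0 <= D x y <= dmax)
  (Delta Pi : R) :
  Rop_emp PXZ D Delta Pi = Rinfo_emp PXZ D Delta Pi.
Proof.
apply/eqP; rewrite eq_le; apply/andP; split.
  apply/ereal_infP => _ [W [hW [hDelta hPi]] <-].
  apply: ereal_inf_lbound; exists (cond_MI PXZ W) => //.
  by exists 0; split=> //; exact: (cond_MI_achievable hP hW hD hDelta hPi).
apply/ereal_infP => _ [r [r0 [r00 hr]] <-].
(* The slack is removed on channels for fixed [r], so continuity of [Rinfo_emp] in its parameters is
   never invoked. *)
have [W [hW hI hDelta hPi]] : exists W, [/\ channel W, cond_MI PXZ W <= r,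
    exp_dist PXZ W D <= Delta & dTV (PX PXZ) (PY PXZ W) <= Pi].
  by apply: (feasible_limit hP) => e e0; exact: (achievable_channel hP r00 e0 hr).
apply: (@le_trans _ _ (cond_MI PXZ W)%:E); last by rewrite lee_fin.
by apply: ereal_inf_lbound; exists W.
Qed.
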